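(* Let $A\subset\mathbb{R}^n$ be a nonempty closed set and let $r\colon \mathrm{bdry}\,A\to(0,+\infty]$ be a continuous function such that $A$ satisfies the extended exterior $r(\cdot)$-sphere condition. Define $\rho\colon A^c\to(0,+\infty]$ by $$\rho(x):=\min\left\{\frac{r(a)}{2} : a\in\mathrm{proj}_A(x)\right\}.$$ Then $\rho(\cdot)$ is lower semicontinuous and $A^c$ is the union of closed balls with radius function $\rho(\cdot)$.
   Context: $\mathbb{R}^n$ carries the Euclidean norm $\|\cdot\|$ and inner product $\langle\cdot,\cdot\rangle$. $A^c$, $\mathrm{int}\,A$, $\mathrm{bdry}\,A$ denote complement in $\mathbb{R}^n$, interior and boundary. $B(y;\sigma)$ and $\bar B(y;\sigma)$ are the open and closed balls with center $y$ and radius $\sigma>0$. $\mathrm{proj}_A(x)$ is the set of points of $A$ closest to $x$. The value $+\infty$ is allowed for $r$ and $\rho$ (with $\frac{+\infty}{2}=+\infty$), and continuity of $r$ is as a map into the extended half-line $(0,+\infty]$. Proximal normal cone: for $A$ nonempty and closed and $a\in A$, $N^P_A(a)$ is the set of $\zeta\in\mathbb{R}^n$ for which there is $\sigma\ge 0$ with $\langle\zeta,x-a\rangle\le\sigma\|x-a\|^2$ for all $x\in A$. Extended exterior $r(\cdot)$-sphere condition: for $A$ nonempty and closed and $r\colon\mathrm{bdry}\,A\to(0,+\infty]$ continuous, $A$ satisfies this condition if for every $a\in\mathrm{bdry}\,A$: - if $a\in\mathrm{bdry}(\mathrm{int}\,A)$, then there exists a unit vector $\zeta_a\in N^P_A(a)$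 such that $B(a+r(a)\zeta_a;r(a))\cap A=\emptyset$ if $r(a)<+\infty$, and $B(a+\rho\zeta_a;\rho)\cap A=\emptyset$ for all $\rho>0$ if $r(a)=+\infty$; - if $a\notin\mathrm{bdry}(\mathrm{int}\,A)$, then for all unit vectors $\zeta_a\in N^P_A(a)$ one has $B(a+r(a)\zeta_a;r(a))\cap A=\emptyset$ if $r(a)<+\infty$, and $B(a+\rho\zeta_a;\rho)\cap A=\emptyset$ for all $\rho>0$ if $r(a)=+\infty$. Union of closed balls: for $\Omega\subset\mathbb{R}^n$ open and $\rho\colon\Omega\to(0,+\infty]$ lower semicontinuous, $\Omega$ is the union of closed balls with radius function $\rho(\cdot)$ if for every $x\in\Omega$ there exists $y_x\in\Omega$ such that: if $\rho(x)<+\infty$, then $x\in\bar B(y_x;\rho(x))\subset\Omega$; if $\rho(x)=+\infty$, then $x\in\bar B(x+\delta(y_x-x);\delta)\subset\Omega$ for all $\delta>0$. *)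

(* Defs.v *)
From HB Require Import structures.
From mathcomp Require Import all_boot all_order all_algebra.
From mathcomp Require Import all_classical all_reals all_analysis.
Set Implicit Arguments.
Unset Strict Implicit.
Unset Printing Implicit Defensive.
Import Order.TTheory GRing.Theory Num.Theory.
Import numFieldNormedType.Exports.
Local Open Scope classical_set_scope.
Local Open Scope ring_scope.

(* The library norm on row vectors is the sup norm, so the Euclidean inner
   product, norm and balls are defined here.  Topological notions (closed,
   interior, boundary, continuity) use the library topology on 'rV[R]_n, which
   coincides with the Euclidean one. *)

Definition inner (R : realType) (n : nat) (u v : 'rV[R]_n) : R :=
  \sum_(i < n) u 0 i * v 0 i.

Definition enorm (R : realType) (n : nat) (u : 'rV[R]_n) : R :=
  Num.sqrt (inner u u).

Definition eball (R : realType) (n : nat) (y : 'rV[R]_n) (s : R) :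
  set 'rV[R]_n := [set x | enorm (x - y) < s].

Definition ecball (R : realType) (n : nat) (y : 'rV[R]_n) (s : R) :
  set 'rV[R]_n := [set x | enorm (x - y) <= s].

Definition bdry (T : topologicalType) (A : set T) : set T :=
  closure A `\` interior A.

Definition eproj (R : realType) (n : nat) (A : set 'rV[R]_n) (x : 'rV[R]_n) :
  set 'rV[R]_n :=
  [set a | A a /\ forall b, A b -> enorm (x - a) <= enorm (x - b)].

Definition prox_normal (R : realType) (n : nat) (A : set 'rV[R]_n)
    (a : 'rV[R]_n) : set 'rV[R]_n :=
  [set zeta | exists2 sigma : R, 0 <= sigma &
     forall x, A x -> inner zeta (x - a) <= sigma * enorm (x - a) ^+ 2].

(* zeta is realized at a by an exterior sphere of radius s; for s = +oo, by
   exterior spheres of all positive radii. *)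
Definition realized (R : realType) (n : nat) (A : set 'rV[R]_n)
    (a zeta : 'rV[R]_n) (s : \bar R) : Prop :=
  (forall t : R, s = t%:E -> eball (a + t *: zeta) t `&` A = set0) /\
  (s = +oo%E ->
     forall t : R, 0 < t -> eball (a + t *: zeta) t `&` A = set0).

(* Only the values of r on bdry A are used. *)
Definition ext_exterior_sphere (R : realType) (n : nat) (A : set 'rV[R]_n)
    (r : 'rV[R]_n -> \bar R) : Prop :=
  forall a, bdry A a ->
    (bdry (interior A) a ->
       exists zeta, [/\ enorm zeta = 1, prox_normal A a zeta
                      & realized A a zeta (r a)]) /\
    (~ bdry (interior A) a ->
       forall zeta, enorm zeta = 1 -> prox_normal A a zeta ->
         realized A a zeta (r a)).

(* Points outside Omega are isolated in subspace Omega, so this constrains the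
   restriction of rho to Omega only. *)
Definition lower_semicontinuous_on (R : realType) (T : topologicalType)
    (Omega : set T) (rho : T -> \bar R) : Prop :=
  lower_semicontinuous (rho : subspace Omega -> \bar R).

Definition union_closed_balls (R : realType) (n : nat) (Omega : set 'rV[R]_n)
    (rho : 'rV[R]_n -> \bar R) : Prop :=
  forall x, Omega x -> exists2 y, Omega y &
    (forall t : R, rho x = t%:E -> ecball y t x /\ ecball y t `<=` Omega) /\
    (rho x = +oo%E -> forall d : R, 0 < d ->
       ecball (x + d *: (y - x)) d x /\
       ecball (x + d *: (y - x)) d `<=` Omega).

Definition half_radii (R : realType) (n : nat) (A : set 'rV[R]_n)
    (r : 'rV[R]_n -> \bar R) (x : 'rV[R]_n) : set (\bar R) :=
  [set (r a * (2^-1)%:E)%E | a in eproj A x].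

(* The infimum of half_radii; that it is a minimum for x outside A has to be
   proved (it amounts to half_radii A r x (half_radius A r x)). *)
Definition half_radius (R : realType) (n : nat) (A : set 'rV[R]_n)
    (r : 'rV[R]_n -> \bar R) (x : 'rV[R]_n) : \bar R :=
  ereal_inf (half_radii A r x).

(* Main.v *)
(* Let x be outside A, a a projection of x on A and v = x - a. The key point is
   that some unit vector z with <v, z> >= 0 is realized at a by exterior balls of
   radius r(a). If a is not in bdry (int A), take z = v / |v|. Otherwise, moving
   along v from an interior point of A close to a, one must leave int A close to
   a, since a + t v is outside A for small t > 0; at the exit point b the normal
   z_b given by the hypothesis satisfies <v, z_b> >= 0, as the path comes from
   inside A, and a cluster point of the z_b as b tends to a is the required z.
   Then every y in A satisfies |y-a|^2 >= 2 <y-a, v> and, if r(a) is finite,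
   |y-a|^2 >= 2 r(a) <y-a, z>. The average |y-a|^2 >= <y-a, v + r(a) z> says that
   A misses the open ball with diameter [a, a + v + r(a) z], whose closure
   contains x and whose radius exceeds r(a)/2. If r(a) is infinite, A misses an
   open half-space whose closure contains x. *)
Require Import Defs.
From HB Require Import structures.
From mathcomp Require Import all_boot all_order all_algebra.
From mathcomp Require Import all_classical all_reals all_analysis.
From mathcomp Require Import ring lra.
Import Order.TTheory GRing.Theory Num.Theory.
Import numFieldNormedType.Exports.
Local Open Scope classical_set_scope.
Local Open Scope ring_scope.

Set Implicit Arguments.
Unset Strict Implicit.
Unset Printing Implicit Defensive.

(** * Euclidean inner product, norm, compactness and projections *)

Section Euclidean.
Context {R : realType} {n : nat}.
Implicit Types (u v w x y z : 'rV[R]_n) (A : set 'rV[R]_n).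

Lemma innerC u v : inner u v = inner v u.
Proof. by apply: eq_bigr => i _; rewrite mulrC. Qed.

Lemma innerDl u v w : inner (u + v) w = inner u w + inner v w.
Proof.
by rewrite /inner -big_split; apply: eq_bigr => i _; rewrite mxE mulrDl.
Qed.

Lemma innerZl (k : R) u v : inner (k *: u) v = k * inner u v.
Proof.
by rewrite /inner big_distrr; apply: eq_bigr => i _; rewrite mxE /= mulrA.
Qed.

Lemma innerDr u v w : inner u (v + w) = inner u v + inner u w.
Proof. by rewrite innerC innerDl !(innerC _ u). Qed.

Lemma innerZr (k : R) u v : inner u (k *: v) = k * inner u v.
Proof. by rewrite innerC innerZl innerC. Qed.

Lemma innerNl u v : inner (- u) v = - inner u v.
Proof. by rewrite -scaleN1r innerZl mulN1r. Qed.

Lemma innerNr u v : inner u (- v) = - inner u v.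
Proof. by rewrite innerC innerNl innerC. Qed.

Definition inner_lin := (innerDl, innerDr, innerNl, innerNr, innerZl, innerZr).

Lemma inner_ge0 u : 0 <= inner u u.
Proof. by apply: sumr_ge0 => i _; rewrite -expr2 sqr_ge0. Qed.

Lemma inner_eq0 u : inner u u = 0 -> u = 0.
Proof.
move=> /eqP; rewrite psumr_eq0 => [/allP u0|i _]; last by rewrite -expr2 sqr_ge0.
apply/rowP => i; rewrite mxE; apply/eqP.
by have := u0 i (mem_index_enum i); rewrite mulf_eq0 orbb.
Qed.

Lemma enorm_ge0 u : 0 <= enorm u.
Proof. exact: sqrtr_ge0. Qed.

Lemma enorm0 : enorm (0 : 'rV[R]_n) = 0.
Proof. by rewrite /enorm -(scale0r 0) innerZl mul0r sqrtr0. Qed.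

Lemma enorm_sqr u : enorm u ^+ 2 = inner u u.
Proof. by rewrite sqr_sqrtr// inner_ge0. Qed.

Lemma enorm_eq1 u : enorm u = 1 <-> inner u u = 1.
Proof.
split=> [u1|u1]; first by rewrite -enorm_sqr u1 expr1n.
by rewrite /enorm u1 sqrtr1.
Qed.

Lemma enorm_leP u (t : R) : 0 <= t -> (enorm u <= t) = (inner u u <= t ^+ 2).
Proof. by move=> t0; rewrite -enorm_sqr ler_pXn2r// nnegrE enorm_ge0. Qed.

Lemma enorm_ltP u (t : R) : 0 <= t -> (enorm u < t) = (inner u u < t ^+ 2).
Proof. by move=> t0; rewrite -enorm_sqr ltr_pXn2r// nnegrE enorm_ge0. Qed.

Lemma enorm_le u v : (enorm u <= enorm v) = (inner u u <= inner v v).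
Proof. by rewrite enorm_leP ?enorm_ge0// enorm_sqr. Qed.

Lemma enormN u : enorm (- u) = enorm u.
Proof. by rewrite /enorm innerNl innerNr opprK. Qed.

Lemma enormB u v : enorm (u - v) = enorm (v - u).
Proof. by rewrite -enormN opprB. Qed.

Lemma cauchy_schwarz u v : inner u v <= enorm u * enorm v.
Proof.
have [/inner_eq0 ->|v0] := eqVneq (inner v v) 0.
  by rewrite -(scale0r (0 : 'rV[R]_n)) innerZr mul0r mulr_ge0// enorm_ge0.
have vv : 0 < inner v v by rewrite lt_neqAle eq_sym v0 inner_ge0.
suff uv : inner u v ^+ 2 <= (enorm u * enorm v) ^+ 2.
  rewrite (le_trans (ler_norm _))// -(ler_pXn2r (ltn0Sn 1)) ?nnegrE//.
    by rewrite real_normK ?num_real.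
  by rewrite mulr_ge0// enorm_ge0.
rewrite exprMn !enorm_sqr -subr_ge0 -(pmulr_rge0 _ vv).
have := inner_ge0 (inner v v *: u - inner u v *: v).
by rewrite !inner_lin (innerC v u); congr (0 <= _); ring.
Qed.

Lemma enorm_triangle u v : enorm (u + v) <= enorm u + enorm v.
Proof.
rewrite enorm_leP ?addr_ge0 ?enorm_ge0// !inner_lin sqrrD !enorm_sqr (innerC v u).
by have := cauchy_schwarz u v; lra.
Qed.

Lemma enorm_triangleB x y z : enorm (x - z) <= enorm (x - y) + enorm (y - z).
Proof. by rewrite (le_trans _ (enorm_triangle _ _))// addrA subrK. Qed.

(** Turns Euclidean bounds into bounds for the sup norm, in which compactness of bounded closed sets
    is stated. *)
Lemma mx_norm_le_enorm u : `|u| <= enorm u.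
Proof.
rewrite [leLHS]/Num.norm /= mx_normrE; apply/bigmax_leP; split=> [|[i j] _ /=].
  exact: enorm_ge0.
rewrite (ord1 i) -(ler_pXn2r (ltn0Sn 1)) ?nnegrE ?enorm_ge0//.
rewrite real_normK ?num_real// enorm_sqr /inner (bigD1 j)//= -expr2 lerDl.
by apply: sumr_ge0 => k _; rewrite -expr2 sqr_ge0.
Qed.

Lemma cvg_inner {T : Type} (F : set_system T) {FF : Filter F}
    (f g : T -> 'rV[R]_n) u v :
  f @ F --> u -> g @ F --> v -> inner (f t) (g t) @[t --> F] --> inner u v.
Proof.
move=> fu gv; apply: cvg_big => [|i _]; first exact: add_continuous.
by apply: cvgM; [apply: (cvg_comp f (fun w => w 0 i) fu)
  |apply: (cvg_comp g (fun w => w 0 i) gv)]; exact: coord_continuous.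
Qed.

Lemma cvg_enormB {T : Type} (F : set_system T) {FF : Filter F}
    (f : T -> 'rV[R]_n) x y :
  f @ F --> y -> enorm (x - f t) @[t --> F] --> enorm (x - y).
Proof.
move=> fy; have xy : (x - f t) @[t --> F] --> x - y.
  by apply: cvgB => //; exact: cvg_cst.
exact: (cvg_comp _ Num.sqrt (cvg_inner xy xy) (@sqrt_continuous _ _)).
Qed.

Lemma continuous_enormB x : continuous (fun y => enorm (x - y)).
Proof. move=> y; have := @cvg_enormB _ (nbhs y) _ (fun t => t) x y.
by apply; exact: cvg_id. Qed.

Lemma closed_ecball x (M : R) : closed (ecball x M).
Proof.
rewrite (_ : ecball x M = (fun y => enorm (x - y)) @^-1` [set t | t <= M]).
  apply: preimage_closed; last exact: closed_le.
  by move=> y _; exact: continuous_enormB.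
by apply/seteqP; split=> y /=; rewrite /ecball/= enormB.
Qed.

Lemma compact_setI_ecball A x (M : R) :
  closed A -> compact (A `&` ecball x M).
Proof.
move=> cA; apply: bounded_closed_compact; last first.
  by apply: closedI => //; exact: closed_ecball.
exists (M + enorm x); split=> [|N MN y [_ xyM]]; first exact: num_real.
apply: le_trans (mx_norm_le_enorm _) _; rewrite -(subrK x y).
rewrite (le_trans (enorm_triangle _ _))// (le_trans _ (ltW MN))// lerD2r.
exact: xyM.
Qed.

Lemma eproj_neq0 A x : A !=set0 -> closed A -> eproj A x !=set0.
Proof.
move=> [a0 Aa0] cA; pose K := A `&` ecball x (enorm (x - a0)).
have K0 : K !=set0 by exists a0; split=> //; rewrite /ecball/= enormB.
have [|a] := @compact_EVT_min _ _ (fun y => enorm (x - y)) K K0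
  (compact_setI_ecball cA).
  by apply: continuous_subspaceT; exact: continuous_enormB.
rewrite inE => -[Aa xa] amin; exists a; split=> // b Ab.
(* Points of [A] outside the ball through [a0] are farther from [x] than [a0], so the minimum over
   [K] is global on [A]. *)
have [xb|xb] := leP (enorm (x - b)) (enorm (x - a0)).
  by apply: (amin b); apply/mem_set; split=> //; rewrite /ecball/= (enormB b).
by rewrite (le_trans _ (ltW xb))// enormB.
Qed.

(** Given one projection [a], the projections are exactly the points of [A] within distance |x - a|
    of [x]. *)
Lemma compact_eproj A x : closed A -> compact (eproj A x).
Proof.
move=> cA; have [->|/set0P[a [Aa amin]]] := eqVneq (eproj A x) set0.
  exact: compact0.
rewrite (_ : eproj A x = A `&` ecball x (enorm (x - a))).
  exact: compact_setI_ecball.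
apply/seteqP; split=> b [Ab bmin]; split=> //; rewrite /ecball/=.
  by rewrite (enormB b); exact: bmin.
by move=> c Ac; rewrite (enormB x) (le_trans bmin)// amin.
Qed.

(** Squared and expanded form of |x - a| <= |x - y|. *)
Lemma eproj_inner A x a y :
  eproj A x a -> A y -> 2 * inner (y - a) (x - a) <= inner (y - a) (y - a).
Proof.
move=> [_ amin] /amin; rewrite enorm_le.
have -> : x - y = (x - a) - (y - a) by rewrite opprB addrA subrK.
move: (x - a) (y - a) => u v; rewrite !inner_lin (innerC v u) => ?; lra.
Qed.

End Euclidean.


(** * Sphere inequalities, their limits, and exit from the interior *)

Section Realized.
Context {R : realType} {n : nat}.
Implicit Types (u v w x y z : 'rV[R]_n) (A : set 'rV[R]_n).

(** Expanding |y - b - p z| >= p gives the inequality for a radius [p] whose ball misses [A]. It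
    passes to smaller radii: the left side is nonpositive or increases with the radius. *)
Lemma realized_inner A b z (s : \bar R) (t : R) y :
  enorm z = 1 -> realized A b z s -> 0 < t -> (t%:E <= s)%E -> A y ->
  2 * t * inner (y - b) z <= inner (y - b) (y - b).
Proof.
move=> /enorm_eq1 z1 [zfin zinf] t0 ts Ay.
have ball_inner (p : R) : 0 < p -> eball (b + p *: z) p `&` A = set0 ->
    2 * p * inner (y - b) z <= inner (y - b) (y - b).
  move=> p0 pA; have : ~ eball (b + p *: z) p y.
    by move=> yp; suff: set0 y by []; rewrite -pA.
  rewrite /eball/= => /negP; rewrite (enorm_ltP _ (ltW p0)) -leNgt opprD addrA.
  by move: (y - b) => w; rewrite !inner_lin (innerC z w) z1 => ?; lra.
case: s zfin zinf ts => [s| |] zfin zinf //; last first.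
  by move=> _; apply: ball_inner => //; exact: zinf.
rewrite lee_fin => ts.
have := ball_inner s (lt_le_trans t0 ts) (zfin s erefl).
have := inner_ge0 (y - b); move: (inner (y - b) (y - b)) (inner (y - b) z).
by move=> N i N0 h; have [i0|i0] := leP i 0; nra.
Qed.

Lemma near_within_gt (T : topologicalType) (D : set T) (f : T -> \bar R) a c :
  {within D, continuous f} -> D a -> (c < f a)%E ->
  \forall b \near a, D b -> (c < f b)%E.
Proof.
move=> /subspace_continuousP/(_ a) fa Da cfa.
apply: (fa Da [set s | c < s]%E); apply: open_nbhs_nbhs.
by split=> //; exact: open_ereal_gt_ereal.
Qed.

(** The sets [S N] of normals at boundary points in [N] generate a proper filter [F], to which the
    compact set [K] belongs; [z] is a cluster point of [F]. No convergent choice of normals is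
    needed. *)
Lemma limit_normal A (r : 'rV[R]_n -> \bar R) a v :
  bdry A a -> {within bdry A, continuous r} ->
  (forall N, nbhs a N -> exists b z, [/\ N b, bdry A b, enorm z = 1,
     0 <= inner v z & realized A b z (r b)]) ->
  exists z, [/\ enorm z = 1, 0 <= inner v z &
    forall (t : R) y, 0 < t -> (t%:E <= r a)%E -> A y ->
      2 * t * inner (y - a) z <= inner (y - a) (y - a)].
Proof.
move=> bAa rcont hN.
pose S (N : set 'rV[R]_n) := [set z | exists b, [/\ N b, bdry A b, enorm z = 1,
  0 <= inner v z & realized A b z (r b)]].
pose F := filter_from (nbhs a) S.
have FF : ProperFilter F.
  apply: filter_from_proper => [|N /hN[b [z h]]]; last by exists z; exists b.
  apply: filter_from_filter => [|N M aN aM]; first by exists setT; exact: filterT.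
  exists (N `&` M); first exact: filterI.
  by move=> z [b [[Nb Mb] bAb z1 vz rz]]; split; exists b.
pose K := [set z | 0 <= inner v z] `&` ([set z | enorm z = 1] `&` ecball 0 1).
have cK : compact K.
  rewrite /K setIA; apply: compact_setI_ecball; apply: closedI.
    apply: (@preimage_closed _ _ (inner v) [set t | 0 <= t]) => [z _|].
      have := @cvg_inner _ _ _ (nbhs z) _ (fun=> v) (fun t => t) v z.
      by apply; [exact: cvg_cst|exact: cvg_id].
    exact: closed_ge.
  rewrite (_ : mkset _ = (fun z => enorm (0 - z)) @^-1` [set 1]); last first.
    by apply/seteqP; split=> z /=; rewrite sub0r enormN.
  apply: preimage_closed => [z _|]; first exact: continuous_enormB.
  exact: closed_eq.
have FK : F K.
  exists setT; first exact: filterT.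
  by move=> z [b [_ _ z1 vz _]]; split=> //; split=> //; rewrite /ecball/= subr0 z1.
have [z [[vz [z1 _]] clz]] := cK F FF FK.
exists z; split=> //.
(* A strict bound t < r(a) persists at boundary points near [a]. If the inequality failed at (a, z),
   it would fail at some nearby (b, z') with [z'] realized at [b]. *)
have ltr (t : R) y : 0 < t -> (t%:E < r a)%E -> A y ->
    2 * t * inner (y - a) z <= inner (y - a) (y - a).
  move=> t0 tra Ay; rewrite leNgt; apply/negP => hlt.
  have : 2 * t * inner (y - p.1) p.2 - inner (y - p.1) (y - p.1)
      @[p --> filter_prod (nbhs a) (nbhs z)] -->
      2 * t * inner (y - a) z - inner (y - a) (y - a).
    have yp : y - p.1 @[p --> filter_prod (nbhs a) (nbhs z)] --> y - a.
      by apply: cvgB; [exact: cvg_cst|exact: cvg_fst].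
    apply: cvgB; last exact: cvg_inner.
    by apply: cvgMl_tmp; apply: cvg_inner => //; exact: cvg_snd.
  move=> /cvgr_gt/(_ 0); rewrite subr_gt0 => /(_ hlt)[[N U] /= [aN zU] NU].
  have aM : nbhs a (N `&` [set b | bdry A b -> (t%:E < r b)%E]).
    by apply: filterI => //; exact: (near_within_gt rcont bAa tra).
  have FS := @in_filter_from _ _ (nbhs a) S _ aM.
  have [z' [[b [[Nb rb] bAb z'1 _ rz']] Uz']] := clz _ _ FS zU.
  have := NU (b, z') (conj Nb Uz'); rewrite /= subr_gt0 ltNge => /negP; apply.
  by apply: (realized_inner z'1 rz') => //; exact/ltW/rb.
move=> t y t0; rewrite le_eqVlt => /orP[/eqP tra|]; last exact: ltr.
move=> Ay; rewrite leNgt; apply/negP; have := inner_ge0 (y - a).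
have {}ltr (p : R) : 0 < p -> p < t ->
    2 * p * inner (y - a) z <= inner (y - a) (y - a).
  by move=> p0 pt; apply: ltr => //; rewrite -tra lte_fin.
move: (inner (y - a) z) (inner (y - a) (y - a)) ltr => i N ltr N0 Ni.
have i0 : 0 < i by nra.
(* For t = r(a), the inequality holds exactly up to the radius [q]; if q < t, the radius midway
   between them contradicts the strict case. *)
pose q := N / (2 * i); have qN : q * (2 * i) = N.
  by rewrite /q divfK//; lra.
have q0 : 0 <= q by rewrite /q divr_ge0//; lra.
have qt : q < t by rewrite -(ltr_pM2r (x := 2 * i)) ?qN; lra.
by have := ltr ((q + t) / 2); nra.
Qed.

(** Take for [s] the least parameter in [0, 1] at which the segment is outside the interior; it is
    positive because [p] is interior. *)
Lemma exit_point A p w : A° p -> ~ A (p + w) -> exists s : R,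
  [/\ 0 < s <= 1, bdry (A°) (p + s *: w) &
      forall t, 0 <= t < s -> A (p + t *: w)].
Proof.
move=> Ap Apw.
have cont : continuous (fun t : R => p + t *: w).
  by move=> t; apply: cvgD; [exact: cvg_cst|exact: scalel_continuous].
pose K := `[0, 1]%classic `&` (fun t : R => p + t *: w) @^-1` (~` A°).
have cK : compact K.
  apply: compact_closedI; first exact: segment_compact.
  apply: preimage_closed => [t _|]; first exact: cont.
  by apply: open_closedC; exact: open_interior.
have K0 : K !=set0.
  exists 1; split; first by rewrite /= in_itv/= ler01 lexx.
  by rewrite /= scale1r => /interior_subset.
have [|s] := @compact_EVT_min _ _ id K K0 cK.
  by apply: continuous_subspaceT => t; exact: cvg_id.
move=> /set_mem[/= s01 As] smin; have /andP[s0 s1] : 0 <= s <= 1.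
  by move: s01; rewrite in_itv.
have intA t : 0 <= t < s -> A° (p + t *: w).
  move=> /andP[t0 ts]; apply: contrapT => At.
  suff /smin : t \in K by rewrite leNgt ts.
  by apply/mem_set; split => //=; rewrite in_itv/= t0 (le_trans (ltW ts)).
have {}s0 : 0 < s.
  rewrite lt_neqAle s0 andbT; apply/eqP => s00; apply: As.
  by rewrite -s00 scale0r addr0.
exists s; split; first by rewrite s0.
- split; last by move=> /interior_subset.
  move=> N /cont/cvg_at_left_filter sN.
  have [t [/andP[t0 ts] Nt]] : exists t, 0 < t < s /\ N (p + t *: w).
    by apply: (@filter_ex _ s^'-); near=> t; split;
      [apply/andP; split; near: t; [exact: nbhs_left_gt|exact: nbhs_left_lt]
      |near: t; exact: sN].
  by exists (p + t *: w); split=> //; apply: intA; rewrite ltW.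
- by move=> t /intA/interior_subset.
Unshelve. all: by end_near. Qed.

End Realized.

(** * Normals at a projection that point towards the projected point *)

Lemma ereal_gt0_real (R : realDomainType) (s : \bar R) :
  (0 < s)%E -> exists2 t : R, 0 < t & (t%:E <= s)%E.
Proof.
case: s => [s| |]//; last by exists 1 => //; exact: leey.
by rewrite lte_fin => s0; exists s.
Qed.

Lemma not_le_mul_near0 (R : realFieldType) (c W s : R) : 0 < c -> 0 <= W ->
  0 < s -> ~ (forall h, 0 < h -> h <= s -> c <= h * W).
Proof.
move=> c0 W0 s0 cW; have W1 : 0 < W + 1 by lra.
(* Chosen so that q W < c; the added 1 allows W = 0. *)
pose q := c / (W + 1); have q0 : 0 < q by rewrite divr_gt0.
have qW : q * (W + 1) = c by rewrite /q divfK// gt_eqF.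
have [qs|/ltW sq] := leP q s; first by have := cW q q0 qs; lra.
have := cW s s0 (lexx s); have : s * W <= q * W by rewrite ler_wpM2r.
lra.
Qed.

Section NormalTowardsPoint.
Context {R : realType} {n : nat}.
Variables (A : set 'rV[R]_n) (r : 'rV[R]_n -> \bar R).
Hypotheses (clA : closed A) (r_gt0 : forall a, bdry A a -> (0 < r a)%E).
Hypotheses (r_cont : {within bdry A, continuous r}).
Hypothesis (sphA : ext_exterior_sphere A r).
Implicit Types (a b v x y z : 'rV[R]_n).

Lemma bdry_interior_sub : bdry A° `<=` bdry A.
Proof.
move=> b [clb ib]; split.
  by move: b clb {ib}; apply: closure_subset; exact: interior_subset.
by move=> Ab; exact: ib (nbhs_interior Ab).
Qed.

Lemma normal_near a v :
  bdry A° a -> (forall t : R, 0 < t <= 1 -> ~ A (a + t *: v)) ->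
  forall N, nbhs a N -> exists b z, [/\ N b, bdry A b, enorm z = 1,
    0 <= inner v z & realized A b z (r b)].
Proof.
move=> [cla _] avA N /nbhs_ballP[e /= e0 aeN].
have v1 : 0 < `|v| + 1 by rewrite ltr_wpDl.
(* With t0 <= 1 and t0 |v| < e/2, a segment from [p] to p + t0 v with [p] within e/2 of [a] stays in
   the [e]-ball around [a]. *)
pose t0 := e / (e + 2 * (`|v| + 1)).
have d0 : 0 < e + 2 * (`|v| + 1) by lra.
have t00 : 0 < t0 by rewrite divr_gt0.
have t01 : t0 <= 1 by rewrite ler_pdivrMr//; lra.
have t0v : t0 * `|v| < e / 2.
  by rewrite mulrAC ltr_pdivrMr//; have := normr_ge0 v; nra.
have : \forall p \near a, ~ A (p + t0 *: v).
  have pw : p + t0 *: v @[p --> nbhs a] --> a + t0 *: v.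
    by apply: cvgD; [exact: cvg_id|exact: cvg_cst].
  apply: (pw (~` A)); apply: open_nbhs_nbhs; split; first exact: closed_openC.
  by apply: avA; rewrite t00.
have e20 : 0 < e / 2 by rewrite divr_gt0.
move=> /filterI/(_ (nbhsx_ballx a _ e20))/cla[p [Ap [pvA pa]]].
have [s [/andP[s0 s1] bb sA]] := exit_point Ap pvA.
set b := p + s *: (t0 *: v) in bb.
have bA := bdry_interior_sub bb.
have [+ _] := sphA bA => /(_ bb)[z [z1 _ rz]].
exists b, z; split=> //.
  apply: aeN; rewrite -ball_normE/= /b opprD addrA.
  rewrite (le_lt_trans (ler_normB _ _))// normrZ normrZ !gtr0_norm//.
  have : `|a - p| < e / 2 by move: pa; rewrite -ball_normE.
  have : s * (t0 * `|v|) <= t0 * `|v| by rewrite ler_piMl// mulr_ge0// ltW.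
  lra.
rewrite leNgt; apply/negP => vz.
have [t t_gt0 tr] := ereal_gt0_real (r_gt0 bA).
(* The points b - h t0 v, passed just before the exit, lie in [A]. The sphere inequality at them,
   divided by [h], is violated for small [h] when <v, z> < 0. *)
have exitn (h : R) : 0 < h -> h <= s ->
    2 * t * - inner (t0 *: v) z <= h * inner (t0 *: v) (t0 *: v).
  move=> h0 hs; have Ay : A (p + (s - h) *: (t0 *: v)) by apply: sA; lra.
  have := realized_inner z1 rz t_gt0 tr Ay.
  rewrite (_ : _ - b = - h *: (t0 *: v)); last first.
    by rewrite /b opprD addrACA subrr add0r -scalerBl addrAC subrr sub0r.
  move: (t0 *: v) => w; rewrite !inner_lin.
  by move: (inner w z) (inner w w) => i W hW; rewrite -(ler_pM2l h0); lra.
have c0 : 0 < - inner (t0 *: v) z by rewrite innerZl; nra.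
have c0' : 0 < 2 * t * - inner (t0 *: v) z by rewrite !mulr_gt0.
exact: not_le_mul_near0 c0' (inner_ge0 _) s0 exitn.
Qed.

Lemma subr_eproj_gt0 x a : ~ A x -> eproj A x a -> 0 < inner (x - a) (x - a).
Proof.
move=> Ax [Aa _]; rewrite lt_neqAle inner_ge0 andbT; apply/eqP => /esym/inner_eq0.
by move/eqP; rewrite subr_eq0 => /eqP xa; rewrite xa in Ax.
Qed.

(** With v = x - a, membership in [A] would give 2 t |v|^2 <= t^2 |v|^2 by [eproj_inner]. *)
Lemma eproj_segment x a (t : R) : ~ A x -> eproj A x a -> 0 < t <= 1 ->
  ~ A (a + t *: (x - a)).
Proof.
move=> Ax ax /andP[t0 t1] /(eproj_inner ax); rewrite addrC addKr.
have := subr_eproj_gt0 Ax ax; rewrite !(innerZl, innerZr).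
move: (inner (x - a) (x - a)) => N N0 h; have tN : 0 < t * N by rewrite mulr_gt0.
by have ttN : t * (t * N) <= t * N by [rewrite ler_piMl// ltW]; lra.
Qed.

Lemma eproj_bdry x a : ~ A x -> eproj A x a -> bdry A a.
Proof.
move=> Ax ax; split; first by apply: subset_closure; case: ax.
move=> Aa.
have cont : a + t *: (x - a) @[t --> (0 : R)] --> a + (0 : R) *: (x - a).
  by apply: cvgD; [exact: cvg_cst|exact: scalel_continuous].
have At : \forall t \near (0 : R)^'+, A (a + t *: (x - a)).
  by apply: cvg_at_right_filter cont _ _; rewrite scale0r addr0.
have [t [t01 /(eproj_segment Ax ax t01)]] : exists t : R,
    0 < t <= 1 /\ A (a + t *: (x - a)); last by [].
apply: (@filter_ex _ (0 : R)^'+); near=> t; split; last by near: t.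
by apply/andP; split; near: t; [exact: nbhs_right_gt|exact: nbhs_right_le].
Unshelve. all: by end_near. Qed.

Lemma normal_towards x a : ~ A x -> eproj A x a ->
  exists z, [/\ enorm z = 1, 0 <= inner (x - a) z &
    forall (t : R) y, 0 < t -> (t%:E <= r a)%E -> A y ->
      2 * t * inner (y - a) z <= inner (y - a) (y - a)].
Proof.
move=> Ax ax; have bAa := eproj_bdry Ax ax.
have [aA|aA] := pselect (bdry A° a).
  apply: limit_normal => //; apply: normal_near => // t.
  exact: eproj_segment.
have v0 := subr_eproj_gt0 Ax ax; have d0 : 0 < enorm (x - a) by rewrite sqrtr_gt0.
pose z := (enorm (x - a))^-1 *: (x - a).
have z1 : enorm z = 1.
  apply/enorm_eq1; rewrite innerZl innerZr mulrA -expr2 -enorm_sqr -exprMn.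
  by rewrite mulVf ?expr1n// gt_eqF.
exists z; split=> //.
  by rewrite innerZr mulr_ge0// ?invr_ge0 ?enorm_ge0// inner_ge0.
move=> t y t0 tr Ay; apply: (realized_inner z1 _ t0 tr Ay).
have [_ /(_ aA z z1)] := sphA bAa; apply.
(* The unit vector z = (x - a) / |x - a| is a proximal normal: [eproj_inner] bounds <z, w - a> by |w
   - a|^2 / (2 |x - a|). *)
exists (enorm (x - a))^-1; first by rewrite invr_ge0 enorm_ge0.
move=> w Aw; rewrite innerZl ler_pM2l ?invr_gt0// enorm_sqr innerC.
by have := eproj_inner ax Aw; have := inner_ge0 (w - a); lra.
Qed.

End NormalTowardsPoint.

(** * Minima of extended real functions on compact sets *)

Lemma ereal_compact_min (R : realType) (T : topologicalType) (f : T -> \bar R)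
    (K : set T) :
  K !=set0 -> compact K -> {within K, continuous f} ->
  (forall a, K a -> 0 <= f a)%E ->
  exists2 a, K a & forall b, K b -> (f a <= f b)%E.
Proof.
move=> [a0 Ka0] cK fc f0; apply: contrapT => nomin.
pose m := ereal_inf (f @` K).
have mle b : K b -> (m <= f b)%E by move=> Kb; apply: ereal_inf_lbound; exists b.
have mlt a : K a -> (m < f a)%E.
  move=> Ka; rewrite lt_neqAle mle// andbT; apply/eqP => ma.
  by apply: nomin; exists a => // b Kb; rewrite -ma mle.
have m0 : (0 <= m)%E by apply: le_ereal_inf_tmp => _ [b Kb <-]; exact: f0.
have mfin : m \is a fin_num.
  by rewrite ge0_fin_numE// (lt_le_trans (mlt _ Ka0))// leey.
(* If the infimum [m] is not attained, each point of [K] has a neighbourhood where [f] exceeds some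
   real above [m]. Compactness makes this real uniform, which contradicts the choice of [m]. *)
have /compact_near_coveringP/(_ _ (fine m)^'+
    (fun c b => K b -> (c%:E < f b)%E) _) := cK.
have near_gt a : K a -> \forall b \near a & c \near (fine m)^'+,
    K b -> (c%:E < f b)%E.
  move=> Ka; have [e me ea] : exists2 e : R, fine m < e & (e%:E < f a)%E.
    have := mlt a Ka; rewrite -{1}(fineK mfin).
    case: (f a) => [s| |]//; last first.
      by exists (fine m + 1); rewrite ?ltry// ltrDl.
    by rewrite lte_fin => ms; exists ((fine m + s) / 2); rewrite ?lte_fin; lra.
  exists ([set b | K b -> (e%:E < f b)%E], [set c | c < e]).
    by split; [exact: (near_within_gt fc Ka ea)|exact: nbhs_right_lt].
  by move=> [b c] /= [eb ce] Kb; rewrite (lt_trans _ (eb Kb))// lte_fin.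
move=> /(_ near_gt) Kc.
have [c [mc Kc']] : exists c, fine m < c /\ K `<=` [set b | K b -> (c%:E < f b)%E].
  by apply: (@filter_ex _ (fine m)^'+); near=> c; split; near: c => //;
    exact: nbhs_right_gt.
have : (c%:E <= m)%E.
  by apply: le_ereal_inf_tmp => _ [b Kb <-]; exact/ltW/Kc'.
by rewrite leNgt -{1}(fineK mfin) lte_fin mc.
Unshelve. all: by end_near. Qed.

Lemma closed_bdry (T : topologicalType) (A : set T) : closed (bdry A).
Proof.
rewrite /bdry setDE; apply: closedI; first exact: closed_closure.
exact/open_closedC/open_interior.
Qed.

(** * Closed balls and half-spaces that avoid the set *)

Section Balls.
Context {R : realType} {n : nat}.
Implicit Types (x a z y : 'rV[R]_n) (A : set 'rV[R]_n).

(** The closed ball of radius T/2 has its center on the segment from [x] to the center x + d of the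
    large ball: at x + d if |d| <= T/2, otherwise at distance T/2 from [x]. In the first case it
    lies inside the large open ball because x - a is nonzero. *)
Lemma ball_of_normal A x a z (T : R) : ~ A x -> 0 < T ->
  enorm z = 1 -> 0 <= inner (x - a) z -> x != a ->
  (forall y, A y -> 2 * inner (y - a) (x - a) <= inner (y - a) (y - a)) ->
  (forall y, A y -> 2 * T * inner (y - a) z <= inner (y - a) (y - a)) ->
  exists2 c, enorm (x - c) <= T / 2 & ecball c (T / 2) `<=` ~` A.
Proof.
move=> Ax T0 /enorm_eq1 z1 vz xa xproj zproj.
have v0 : 0 < inner (x - a) (x - a).
  rewrite lt_neqAle inner_ge0 andbT; apply: contra xa => /eqP/esym/inner_eq0.
  by move/eqP; rewrite subr_eq0.
have [d dE] : exists d, d = 2^-1 *: (T *: z - (x - a)) by eexists.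
have sub y (k : R) : y - (x + k *: d) = (y - a) - (x - a) - k *: d.
  by rewrite opprB addrA subrK opprD addrA.
have T20 : 0 <= T / 2 by rewrite divr_ge0// ltW.
(* x + d is the center of the ball with diameter [a, a + (x - a) + T z]. *)
have [dT|Td] := leP (inner d d) ((T / 2) ^+ 2).
  exists (x + 1 *: d).
    by rewrite scale1r opprD addrA subrr sub0r enormN enorm_leP.
  move=> y; rewrite /ecball/= enorm_leP// sub => yc Ay.
  move: yc (xproj y Ay) (zproj y Ay) v0 vz {dT}.
  rewrite dE; move: (y - a) (x - a) => u v; rewrite !inner_lin z1.
  rewrite (innerC v u) (innerC z u) (innerC z v) => *; nra.
have d0 : 0 < inner d d by rewrite (le_lt_trans _ Td)// exprn_ge0.
pose k := T / 2 / enorm d.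
have ed0 : 0 < enorm d by rewrite sqrtr_gt0.
have k0 : 0 <= k by rewrite divr_ge0// enorm_ge0.
have k1 : k < 1 by rewrite ltr_pdivrMr// mul1r ltNge enorm_leP// -ltNge.
have kd : k ^+ 2 * inner d d = (T / 2) ^+ 2.
  by rewrite -enorm_sqr -exprMn divfK// gt_eqF.
exists (x + k *: d).
  rewrite opprD addrA subrr sub0r enormN enorm_leP// innerZl innerZr.
  by rewrite mulrA -expr2 kd.
move=> y; rewrite /ecball/= enorm_leP// -kd sub => yc Ay.
(* The small ball can meet the large sphere only at [x]: for [y] in [A] and in the small ball, |y -
   x|^2 <= 2 k <y - x, d> <= k |y - x|^2 with k < 1. *)
suff /inner_eq0 /eqP : inner (y - x) (y - x) = 0.
  by rewrite subr_eq0 => /eqP yx; rewrite yx in Ay.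
have yxa : y - x = (y - a) - (x - a) by rewrite opprB addrA subrK.
rewrite -yxa in yc.
have : inner (y - x) (y - x) <= k * (2 * inner (y - x) d).
  by move: yc; move: (y - x) => w; rewrite !inner_lin (innerC d w) => ?; lra.
have : 2 * inner (y - x) d <= inner (y - x) (y - x).
  move: (xproj y Ay) (zproj y Ay) (mulr_ge0 (ltW T0) vz); rewrite yxa dE.
  move: (y - a) (x - a) => u v; rewrite !inner_lin.
  rewrite (innerC v u) => *; lra.
have := inner_ge0 (y - x).
move: (inner (y - x) (y - x)) (inner (y - x) d) => N i N0 iN Ni.
apply/eqP; rewrite eq_le N0 andbT leNgt; apply/negP => Npos.
have : k * (2 * i) <= k * N by rewrite ler_wpM2l.
have : k * N < N by rewrite gtr_pMl.
lra.
Qed.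

(** A point [y] of the ball satisfies |y - x|^2 <= 2 t <y - x, z>; if [y] is in [A], the right side
    is nonpositive, so y = x, which is outside [A]. *)
Lemma halfspace_of_normal A x a z (t : R) : ~ A x -> enorm z = 1 ->
  0 <= inner (x - a) z -> (forall y, A y -> inner (y - a) z <= 0) -> 0 < t ->
  ecball (x + t *: z) t x /\ ecball (x + t *: z) t `<=` ~` A.
Proof.
move=> Ax /enorm_eq1 z1 vz zproj t0; have t0' := ltW t0; split.
  rewrite /ecball/= opprD addrA subrr sub0r enormN enorm_leP//.
  by rewrite innerZl innerZr z1 mulr1 expr2.
move=> y; rewrite /ecball/= enorm_leP// opprD addrA => yc Ay.
suff /inner_eq0 /eqP : inner (y - x) (y - x) = 0.
  by rewrite subr_eq0 => /eqP yx; rewrite yx in Ay.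
apply/eqP; rewrite eq_le inner_ge0 andbT.
have : inner (y - x) z <= 0.
  have -> : y - x = (y - a) - (x - a) by rewrite opprB addrA subrK.
  by have := zproj y Ay; rewrite !(innerDl, innerNl) in vz *; lra.
move: yc; move: (y - x) => w; rewrite !inner_lin z1 (innerC z w) => *; nra.
Qed.

End Balls.

(** * Attainment, semicontinuity and balls for the half radius *)

Section HalfRadius.
Context {R : realType} {n : nat}.
Variables (A : set 'rV[R]_n) (r : 'rV[R]_n -> \bar R).
Hypotheses (A0 : A !=set0) (clA : closed A).
Hypotheses (r_gt0 : forall a, bdry A a -> (0 < r a)%E).
Hypotheses (r_cont : {within bdry A, continuous r}).

Lemma half_radius_attained x : ~ A x -> exists a, [/\ eproj A x a,
  half_radius A r x = (r a * (2^-1)%:E)%E &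
  forall b, eproj A x b -> (r a <= r b)%E].
Proof.
move=> Ax.
have [] := @ereal_compact_min _ _ r _ (eproj_neq0 x A0 clA) (compact_eproj clA).
- by apply: continuous_subspaceW r_cont => a; exact: eproj_bdry.
- by move=> a /(eproj_bdry Ax)/r_gt0/ltW.
move=> a ax amin; exists a; split=> //; apply/eqP; rewrite eq_le; apply/andP; split.
  by apply: ereal_inf_lbound; exists a.
apply: le_ereal_inf_tmp => _ [b bx <-]; apply: lee_wpmul2r; last exact: amin.
by rewrite lee_fin invr_ge0.
Qed.

Lemma lt_half (c : R) (s : \bar R) :
  (c%:E < s * (2^-1)%:E)%E = ((2 * c)%:E < s)%E.
Proof.
case: s => [s| |].
- by rewrite -EFinM !lte_fin ltr_pdivlMr// mulrC.
- by rewrite gt0_mulye ?lte_fin ?invr_gt0// !ltry.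
- by rewrite gt0_mulNye ?lte_fin ?invr_gt0// !ltNge !leNye.
Qed.

(* The boundary points with [r b <= 2 c] form a closed set; it is farther from
   [x] than [A] is, hence from all points near [x]. *)
Lemma half_radius_near_gt x (c : R) : ~ A x -> (c%:E < half_radius A r x)%E ->
  \forall y \near x, ~ A y -> (c%:E < half_radius A r y)%E.
Proof.
move=> Ax cx.
suff : \forall y \near x, ~ A y ->
    forall b, eproj A y b -> ((2 * c)%:E < r b)%E.
  apply: filterS => y h Ay.
  have [b [yb -> _]] := half_radius_attained Ay.
  by rewrite lt_half; exact: h Ay b yb.
have xr b : eproj A x b -> ((2 * c)%:E < r b)%E.
  have [a [_ ra amin]] := half_radius_attained Ax.
  by move: cx; rewrite ra lt_half => ca /amin; exact: lt_le_trans.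
have [a [Aa amin]] := eproj_neq0 x A0 clA.
pose S := bdry A `&` [set b | (r b <= (2 * c)%:E)%E].
have SA b : S b -> A b by move=> [[+ _] _]; rewrite -(closure_id A).1.
have clS : closed S.
  move=> b clb; have bAb : bdry A b.
    by apply: closed_bdry; move: b clb; apply: closure_subset => b [].
  split=> //=; rewrite leNgt; apply/negP => cb.
  have [s [[bAs /= sc] cs]] := clb _ (near_within_gt r_cont bAb cb).
  by have := cs bAs; rewrite ltNge sc.
have r_proj y b : ~ A y -> eproj A y b -> ~ S b -> ((2 * c)%:E < r b)%E.
  by move=> Ay yb Sb; rewrite ltNge; apply/negP => rb; apply: Sb; split=> //;
    exact: eproj_bdry yb.
have [S0|S0] := pselect (S !=set0); last first.
  by near=> y => Ay b yb; apply: (r_proj y) => // Sb; apply: S0; exists b.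
have [s [Ss smin]] := eproj_neq0 x S0 clS.
(* Otherwise [s] would be a projection of [x] on [A] with r(s) <= 2 c. *)
have as_lt : enorm (x - a) < enorm (x - s).
  rewrite ltNge; apply/negP => sa.
  have /xr : eproj A x s.
    by split=> [|b Ab]; [exact: SA|exact: le_trans sa (amin b Ab)].
  by case: Ss => _ /=; rewrite leNgt => /negP.
(* For such [y], any projection [b] has |x - b| <= 2 |x - y| + |x - a| < |x - s|, so it is not in
   [S]. *)
have : \forall y \near x, enorm (x - y) < (enorm (x - s) - enorm (x - a)) / 2.
  have /cvgr_lt := @continuous_enormB R n x x; apply.
  by rewrite subrr enorm0; lra.
apply: filterS => y xy Ay b yb; apply: (r_proj y) => // Sb.
have := smin b Sb; have := enorm_triangleB x y b.
have := enorm_triangleB y x a; rewrite (enormB y x).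
by case: yb => _ /(_ a Aa); lra.
Unshelve. all: by end_near. Qed.

Lemma half_radius_lsc : lower_semicontinuous_on (~` A) (half_radius A r).
Proof.
move=> x c cx; exists [set y | (c%:E < half_radius A r y)%E] => //.
(* At a point of [A] the subspace neighbourhoods are the sets containing it, and the claim is
   immediate. *)
case: (nbhs_subspaceP (~` A) x) => [Ax|_]; last by move=> y ->.
exact: half_radius_near_gt.
Qed.

Lemma half_radius_balls : ext_exterior_sphere A r ->
  union_closed_balls (~` A) (half_radius A r).
Proof.
move=> sphA x Ax; have [a [ax -> _]] := half_radius_attained Ax.
have [z [z1 vz zA]] := normal_towards clA r_gt0 r_cont sphA Ax ax.
have := r_gt0 (eproj_bdry Ax ax).
case: (r a) zA => [s| |]// zA; last first.
  have zproj y : A y -> inner (y - a) z <= 0.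
    move=> Ay; rewrite leNgt; apply/negP => i0.
    apply: (not_le_mul_near0 (s := 1) i0 (inner_ge0 (y - a))) => // h h0 _.
    (* Radius 1/(2h) gives <y - a, z> <= h |y - a|^2 for every h > 0. *)
    have := zA (2 * h)^-1 y; rewrite invr_gt0 leey => /(_ _ isT Ay).
    rewrite (mulr_gt0 _ h0)// => /(_ isT) hi.
    rewrite -ler_pdivrMl// (le_trans _ hi)//.
    by rewrite invfM mulrA divff ?mul1r// pnatr_eq0.
  (* This point is outside [A] since <x + z - a, z> >= 1. *)
  exists (x + z).
    move=> /zproj; rewrite addrAC innerDl (enorm_eq1 z).1//; lra.
  split=> [t|_ t t0]; first by rewrite gt0_mulye// lte_fin invr_gt0.
  by rewrite addrAC subrr add0r; exact: halfspace_of_normal zproj t0.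
rewrite lte_fin => s0.
have [||c xc cA] := ball_of_normal Ax s0 z1 vz _ (fun y => eproj_inner ax).
- by apply/eqP => xa; apply: Ax; rewrite xa; case: ax.
- by move=> y; exact: zA.
exists c.
  apply: cA; rewrite /ecball/= subrr enorm0.
  by rewrite divr_ge0// ltW.
by split=> // t []  <-.
Qed.

End HalfRadius.

Theorem theorem3p1 (R : realType) (n : nat) (A : set 'rV[R]_n)
    (r : 'rV[R]_n -> \bar R) :
  A !=set0 -> closed A ->
  (forall a, bdry A a -> (0 < r a)%E) ->
  {within bdry A, continuous r} ->
  ext_exterior_sphere A r ->
  let rho := half_radius A r in
  [/\ forall x, (~` A) x -> half_radii A r x (rho x) /\ (0 < rho x)%E,
      lower_semicontinuous_on (~` A) rho
    & union_closed_balls (~` A) rho].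
Proof.
move=> A0 clA r_gt0 r_cont sphA rho; split.
- move=> x Ax; have [a [ax rhox _]] := half_radius_attained A0 clA r_gt0 r_cont Ax.
  rewrite /rho rhox; split; first by exists a.
  by rewrite lt_half mulr0 r_gt0//; exact: eproj_bdry ax.
- exact: half_radius_lsc.
- exact: half_radius_balls.
Qed.
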